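(* Let the operation $\mathbin{|}$ satisfy $(|* )$ $\quad(\Sigma_1\times\Sigma_1')\mathbin{|}(\Sigma_2\times\Sigma_2')=(\Sigma_1\mathbin{|}\Sigma_2)\times(\Sigma_1'\mathbin{|}\Sigma_2')$ for all disjoint $Y,Y'\subseteq L$, $\Sigma_1,\Sigma_2\subseteq\Pi_Y$, $\Sigma_1',\Sigma_2'\subseteq\Pi_{Y'}$. Let $J\subseteq L$, let $\rho$ be a formula written in the sublanguage $J$, let $\varphi,\psi$ be consistent formulas written in $L\setminus J$, and let $\varphi',\psi'$ be consistent formulas written in $J'\subseteq J$. If $(\varphi\wedge\varphi')*(\psi\wedge\psi')\vdash\rho$, then $\varphi'*\psi'\vdash\rho$.
   Context: Classical propositional language with variable set $L$; for $Y\subseteq L$, $\Pi_Y=\{0,1\}^Y$, and for disjoint $Y,Y'$ the set $\Pi_{Y\cup Y'}$ is identified with $\Pi_Y\times\Pi_{Y'}$. $M(\varphi)\subseteq\Pi_L$ is the set of models of $\varphi$; $Th(A)$ is the set of formulas true in all models in $A$. On each $\Pi_Y$ a distance $d$ is given: its values lie in a totally ordered set with least element $0$, and $d(x,y)=0$ iff $x=y$. For $A,B\subseteq\Pi_Y$, $$A\mathbin{|}B=\{b\in B:\ \exists a\in A\ \neg\exists a'\in A,b'\in B\ (d(a',b')<d(a,b))\},$$ and it is assumed that $A\mathbin{|}B\neq\emptyset$ whenever $A,B\ne\emptyset$. The revision operator is $\chi*\eta=Th(M(\chi)\mathbin{|}M(\eta))$. *)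

(* Defs.v *)
From mathcomp Require Import all_boot all_order.
From mathcomp Require Import boolp classical_sets.
Set Implicit Arguments.
Unset Strict Implicit.
Unset Printing Implicit Defensive.

Local Open Scope classical_set_scope.

Inductive form (L : Type) : Type :=
| Var of L
| Bot
| And of form L & form L
| Or of form L & form L
| Imp of form L & form L.
Arguments Bot {L}.

Definition Neg (L : Type) (p : form L) : form L := Imp p Bot.

Fixpoint vars (L : Type) (p : form L) : set L :=
  match p with
  | Var x => [set x]
  | Bot => set0
  | And p q | Or p q | Imp p q => vars p `|` vars q
  end.

(* Classical natural deduction; [T] is the set of open assumptions.  The
   weaker rule [Bot |- p] is the instance of [der_raa] in which the assumption
   [Neg p] is not used. *)
Inductive derives (L : Type) (T : set (form L)) : form L -> Prop :=
| der_ax p : T p -> derives T p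
| der_andI p q : derives T p -> derives T q -> derives T (And p q)
| der_andE1 p q : derives T (And p q) -> derives T p
| der_andE2 p q : derives T (And p q) -> derives T q
| der_orI1 p q : derives T p -> derives T (Or p q)
| der_orI2 p q : derives T q -> derives T (Or p q)
| der_orE p q r : derives T (Or p q) ->
    derives (p |` T) r -> derives (q |` T) r -> derives T r
| der_impI p q : derives (p |` T) q -> derives T (Imp p q)
| der_impE p q : derives T (Imp p q) -> derives T p -> derives T q
| der_raa p : derives (Neg p |` T) Bot -> derives T p.

Definition consistent (L : Type) (p : form L) : Prop := ~ derives [set p] Bot.

Definition Pi (L : Type) (Y : set L) : Type := Y -> bool.

Definition restr (L : Type) (Y Z : set L) (YZ : Y `<=` Z) (m : Pi Z) : Pi Y :=
  fun i => m (SigSub (mem_set (YZ _ (set_valP i)))).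

(* For disjoint [Y] and [Y'], restriction to [Y] and to [Y'] is the
   identification of [Pi (Y `|` Y')] with [Pi Y * Pi Y']; through it this is
   the cartesian product of [S] and [S']. *)
Definition prodPi (L : Type) (Y Y' : set L) (S : set (Pi Y)) (S' : set (Pi Y')) :
    set (Pi (Y `|` Y')) :=
  [set m | S (restr (@subsetUl _ Y Y') m) /\ S' (restr (@subsetUr _ Y Y') m)].

Fixpoint sat (L : Type) (m : Pi [set: L]) (p : form L) : bool :=
  match p with
  | Var x => m (SigSub (in_setT x))
  | Bot => false
  | And p q => sat m p && sat m q
  | Or p q => sat m p || sat m q
  | Imp p q => sat m p ==> sat m q
  end.

Definition M (L : Type) (p : form L) : set (Pi [set: L]) := [set m | sat m p].

Definition Th (L : Type) (A : set (Pi [set: L])) : set (form L) :=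
  [set p | forall m, A m -> sat m p].

Definition closest (disp : Order.disp_t) (D : bOrderType disp) (X : Type)
    (d : X -> X -> D) (A B : set X) : set X :=
  [set b | B b /\ exists2 a, A a &
    ~ exists a' b', [/\ A a', B b' & (d a' b' < d a b)%O]].

Definition revise (disp : Order.disp_t) (D : bOrderType disp) (L : Type)
    (d : Pi [set: L] -> Pi [set: L] -> D) (p q : form L) : set (form L) :=
  Th (closest d (M p) (M q)).

(* Main.v *)
Require Import Defs.
From mathcomp Require Import all_boot all_order.
From mathcomp Require Import boolp classical_sets.
Set Implicit Arguments.
Unset Strict Implicit.
Unset Printing Implicit Defensive.
Local Open Scope classical_set_scope.


(** The language splits into [~` J] and [J].  A formula written in one of the
    two parts has as its set of models a full cylinder over the projection of
    these models to that part, so [M (And phi phi')] is a product [A * A'],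
    with [A] over [~` J] and [A'] over [J]; likewise [M (And psi psi')] is
    [B * B'].  The models of [phi'] alone form [setT * A'], those of [psi']
    form [setT * B'].  Writing [A | B] for [closest _ A B], the product law
    turns the two revisions into [(A | B) * (A' | B')] and
    [(setT | setT) * (A' | B')].  The two products share the factor
    [A' | B'], and that is all that a formula written in [J] can see.  Given a
    point of the second product, it is thus enough to replace its part over
    [~` J] by a point of [A | B], which moves it into the first product, where
    [rho] holds.

    That [A | B] has a point follows from [A] and [B] being nonempty.  Here
    consistency, which is defined by derivability, has to be turned into
    satisfiability; this is [consistent_sat], the completeness theorem
    for one formula.  Conversely [soundness] reads the hypothesis on [rho]
    semantically.  The conclusion needs no proof theory: a formula true in all
    closest models belongs to their theory and is an assumption. *)

(** * Soundness, and completeness for one formula *)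

Lemma soundness (L : Type) (T : set (form L)) (p : form L) (m : Pi [set: L]) :
  derives T p -> (forall q, T q -> sat m q) -> sat m p.
Proof.
elim=> {T p} [T p Tp|T p q _ IHp _ IHq|T p q _ IH|T p q _ IH|T p q _ IH
  |T p q _ IH|T p q r _ IH _ IHp _ IHq|T p q _ IH|T p q _ IHpq _ IHp|T p _ IH] mT.
- exact: mT.
- by rewrite /= IHp ?IHq.
- by have /andP[] := IH mT.
- by have /andP[] := IH mT.
- by rewrite /= IH.
- by rewrite /= IH ?orbT.
- have /orP[mp|mq] := IH mT.
    by apply: IHp => s [->|/mT].
  by apply: IHq => s [->|/mT].
- by apply/implyP => mp; apply: IH => s [->|/mT].
- exact: (implyP (IHpq mT) (IHp mT)).
- apply/negPn/negP => /negbTE mp.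
  suff : sat m (@Bot L) by [].
  by apply: IH => s [->|/mT //]; rewrite /= mp.
Qed.

Lemma derives_weaken (L : Type) (T T' : set (form L)) (p : form L) :
  T `<=` T' -> derives T p -> derives T' p.
Proof.
move=> TT' Tp; elim: Tp T' TT' => {T p}
  [T p Tp|T p q _ IHp _ IHq|T p q _ IH|T p q _ IH|T p q _ IH
  |T p q _ IH|T p q r _ IH _ IHp _ IHq|T p q _ IH|T p q _ IHpq _ IHp|T p _ IH]
  T' TT'.
- exact/der_ax/TT'.
- by apply: der_andI; [exact: IHp | exact: IHq].
- by apply: (@der_andE1 _ _ p q); apply: IH.
- by apply: (@der_andE2 _ _ p q); apply: IH.
- by apply: der_orI1; apply: IH.
- by apply: der_orI2; apply: IH.
- apply: (@der_orE _ _ p q); first exact: IH.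
    by apply: IHp; apply: setUS.
  by apply: IHq; apply: setUS.
- by apply: der_impI; apply: IH; apply: setUS.
- by apply: (@der_impE _ _ p); [exact: IHpq | exact: IHp].
- by apply: der_raa; apply: IH; apply: setUS.
Qed.

Lemma derives_weaken1 (L : Type) (T : set (form L)) (q p : form L) :
  derives T p -> derives (q |` T) p.
Proof. by apply: derives_weaken => r; right. Qed.

Lemma derives_head (L : Type) (T : set (form L)) (p : form L) :
  derives (p |` T) p.
Proof. by apply: der_ax; left. Qed.

Definition decides (L : Type) (T : set (form L)) (x : L) : Prop :=
  T (Var x) \/ T (Neg (Var x)).

(** A Lindenbaum extension restricted to the variables of one formula: only
    finitely many literals are added, so it is built by recursion on the
    formula, with no maximality argument. *)
Lemma extend_decides (L : Type) (p : form L) (T : set (form L)) :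
  ~ derives T Bot ->
  exists T', [/\ T `<=` T', ~ derives T' Bot & forall x, vars p x -> decides T' x].
Proof.
have step2 (q r : form L) :
    (forall T, ~ derives T Bot -> exists T',
       [/\ T `<=` T', ~ derives T' Bot & forall x, vars q x -> decides T' x]) ->
    (forall T, ~ derives T Bot -> exists T',
       [/\ T `<=` T', ~ derives T' Bot & forall x, vars r x -> decides T' x]) ->
    forall T, ~ derives T Bot -> exists T', [/\ T `<=` T', ~ derives T' Bot &
       forall x, (vars q `|` vars r) x -> decides T' x].
  move=> IHq IHr {}T /IHq[T1 [TT1 /IHr[T2 [T12 con2 dec2]] dec1]].
  exists T2; split=> //; first exact: subset_trans T12.
  by move=> x [/dec1[]/T12|/dec2//]; [left|right].
elim: p T => [v|T con|q IHq r IHr|q IHq r IHr|q IHq r IHr];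
  [|by exists T; split|exact: step2|exact: step2|exact: step2].
move=> T con.
have [incon|con'] := pselect (derives (Var v |` T) Bot); last first.
  exists (Var v |` T); split=> [r|//|x ->]; first by right.
  by left; left.
exists (Neg (Var v) |` T); split; first by move=> r; right.
  (* T refutes [Var v] and would refute [Neg (Var v)] as well. *)
  by move=> incon'; apply: con; apply: der_impE (der_impI incon') (der_impI incon).
by move=> x ->; right; left.
Qed.

(** Kalmar's lemma: once the literals true in [m] are derivable, induction on
    the formula carries the truth tables over to derivations. *)
Lemma derives_sat (L : Type) (T : set (form L)) (m : Pi [set: L]) (p : form L) :
  (forall x, vars p x ->
     derives T (if sat m (Var x) then Var x else Neg (Var x))) ->
  derives T (if sat m p then p else Neg p).
Proof.
have refute (q r : form L) (U : set (form L)) :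
    derives U (Neg q) -> derives U q -> derives U r.
  move=> Unq Uq; apply: der_raa; apply: derives_weaken1; exact: der_impE Unq Uq.
elim: p => [v||p IHp q IHq|p IHp q IHq|p IHp q IHq] lits.
- exact: lits.
- exact/der_impI/derives_head.
all: have {IHp} := IHp (fun x vx => lits x (or_introl vx)).
all: have {IHq} := IHq (fun x vx => lits x (or_intror vx)).
all: rewrite /=; case: (sat m p); case: (sat m q) => /= Tq Tp.
- exact: der_andI.
- apply: der_impI; apply: der_impE (derives_weaken1 _ Tq) _.
  exact: der_andE2 (derives_head _ _).
- apply: der_impI; apply: der_impE (derives_weaken1 _ Tp) _.
  exact: der_andE1 (derives_head _ _).
- apply: der_impI; apply: der_impE (derives_weaken1 _ Tp) _.
  exact: der_andE1 (derives_head _ _).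
- exact: der_orI1.
- exact: der_orI1.
- exact: der_orI2.
- apply: der_impI; apply: (der_orE (derives_head _ _)).
    exact: der_impE (derives_weaken1 _ (derives_weaken1 _ Tp)) (derives_head _ _).
  exact: der_impE (derives_weaken1 _ (derives_weaken1 _ Tq)) (derives_head _ _).
- exact/der_impI/derives_weaken1.
- apply: der_impI; apply: der_impE (derives_weaken1 _ Tq) _.
  exact: der_impE (derives_head _ _) (derives_weaken1 _ Tp).
- exact/der_impI/derives_weaken1.
- apply: der_impI; exact: refute (derives_weaken1 _ Tp) (derives_head _ _).
Qed.

(** In a consistent theory that decides the variables of [p], the variables it
    contains form a model of [p]: otherwise [Neg p] is derivable by
    [derives_sat]. *)
Lemma consistent_sat (L : Type) (p : form L) : consistent p -> M p !=set0.
Proof.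
move=> /(extend_decides p)[T [pT con dec]].
pose m : Pi [set: L] := fun i => `[< T (Var (val i)) >].
exists m; apply/negPn/negP => /negbTE mp.
have : derives T (if sat m p then p else Neg p).
  apply: derives_sat => x /dec Tx /=; rewrite /m /=.
  by case: asboolP => // nTx; apply: der_ax; case: Tx.
rewrite mp => Tnp; apply: con; apply: der_impE Tnp _.
exact/der_ax/pT.
Qed.

(** * Valuations over parts of the language *)

Lemma restr_eq (L : Type) (Y Z : set L) (YZ : Y `<=` Z) (m m' : Pi Z) (i : Z) :
  Y (val i) -> restr YZ m = restr YZ m' -> m i = m' i.
Proof.
move=> Yi /(congr1 (fun f => f (SigSub (mem_set Yi)))); rewrite /restr.
by rewrite (_ : SigSub _ = i) //; apply: val_inj.
Qed.

Lemma sat_restr (L : Type) (Y : set L) (m m' : Pi [set: L]) (p : form L) :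
  vars p `<=` Y ->
  restr (@subsetT _ Y) m = restr (@subsetT _ Y) m' -> sat m p = sat m' p.
Proof.
move=> pY eqm.
elim: p pY => [v|//|p IHp q IHq|p IHp q IHq|p IHp q IHq] /= pY.
- by apply: restr_eq eqm; apply: pY.
all: by rewrite IHp ?IHq // => x vx; apply: pY; [right|left].
Qed.

Lemma restr_glue (L : Type) (Y Y' Z : set L) (YZ : Y `<=` Z) (Y'Z : Y' `<=` Z)
    (x : Pi Y) (y : Pi Y') :
  Y `&` Y' = set0 -> exists m : Pi Z, restr YZ m = x /\ restr Y'Z m = y.
Proof.
move=> YY'.
exists (fun i => match pselect (Y (val i)), pselect (Y' (val i)) with
  | left Yi, _ => x (SigSub (mem_set Yi))
  | right _, left Y'i => y (SigSub (mem_set Y'i))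
  | right _, right _ => false
  end); split; apply/funext => i; rewrite /restr /=.
- case: pselect => [Yi|[]]; last exact: set_valP.
  by congr x; apply: val_inj.
- case: pselect => [Yi|_].
    suff : (Y `&` Y') (val i) by rewrite YY'.
    by split=> //; exact: set_valP.
  case: pselect => [Y'i|[]]; last exact: set_valP.
  by congr y; apply: val_inj.
Qed.

(** A formula sees only the coordinates of its variables, so its set of models
    is a cylinder over its projection. *)
Lemma M_cylinder (L : Type) (Y : set L) (p : form L) (m : Pi [set: L]) :
  vars p `<=` Y ->
  M p m <-> (restr (@subsetT _ Y) @` M p) (restr (@subsetT _ Y) m).
Proof.
move=> pY; split=> [mp|[m' m'p eqm]]; first by exists m.
by rewrite /M /= -(sat_restr pY eqm).
Qed.

(** [prodPi] read inside any [Z] equal to the union: [Y `|` Y'] is only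
    provably equal to the whole language, so [Pi (Y `|` Y')] and [Pi Z] are
    different types. *)
Definition prodIn (L : Type) (Y Y' Z : set L) (YZ : Y `<=` Z) (Y'Z : Y' `<=` Z)
    (S : set (Pi Y)) (S' : set (Pi Y')) : set (Pi Z) :=
  [set m | S (restr YZ m) /\ S' (restr Y'Z m)].

Lemma closest_prodIn (L : Type) (disp : Order.disp_t)
    (D : set L -> bOrderType disp) (d : forall Y : set L, Pi Y -> Pi Y -> D Y)
    (Y Y' Z : set L) (YZ : Y `<=` Z) (Y'Z : Y' `<=` Z)
    (S1 S2 : set (Pi Y)) (S1' S2' : set (Pi Y')) :
  closest (@d (Y `|` Y')) (prodPi S1 S1') (prodPi S2 S2') =
    prodPi (closest (@d Y) S1 S2) (closest (@d Y') S1' S2') ->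
  Y `|` Y' = Z ->
  closest (@d Z) (prodIn YZ Y'Z S1 S1') (prodIn YZ Y'Z S2 S2') =
    prodIn YZ Y'Z (closest (@d Y) S1 S2) (closest (@d Y') S1' S2').
Proof.
move=> prodE ZE; case: Z / ZE in YZ Y'Z *.
by rewrite (Prop_irrelevance YZ (@subsetUl _ Y Y'))
  (Prop_irrelevance Y'Z (@subsetUr _ Y Y')).
Qed.

(** * Revision and the splitting of the language *)

Theorem lemma5p3p6 (L : Type) (disp : Order.disp_t)
  (D : set L -> bOrderType disp)
  (d : forall Y : set L, Pi Y -> Pi Y -> D Y)
  (d_eq0 : forall (Y : set L) (x y : Pi Y), d Y x y = (\bot)%O <-> x = y)
  (closest_neq0 : forall (Y : set L) (A B : set (Pi Y)),
     A !=set0 -> B !=set0 -> closest (d Y) A B !=set0)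
  (closest_prod : forall Y Y' : set L, Y `&` Y' = set0 ->
     forall (S1 S2 : set (Pi Y)) (S1' S2' : set (Pi Y')),
     closest (d (Y `|` Y')) (prodPi S1 S1') (prodPi S2 S2') =
     prodPi (closest (d Y) S1 S2) (closest (d Y') S1' S2'))
  (J J' : set L) (rho phi psi phi' psi' : form L) :
  vars rho `<=` J ->
  vars phi `<=` setT `\` J -> vars psi `<=` setT `\` J ->
  consistent phi -> consistent psi ->
  J' `<=` J ->
  vars phi' `<=` J' -> vars psi' `<=` J' ->
  consistent phi' -> consistent psi' ->
  derives (revise (d [set: L]) (And phi phi') (And psi psi')) rho ->
  derives (revise (d [set: L]) phi' psi') rho.
Proof.
move=> rhoJ phiY psiY cphi cpsi J'J phiJ' psiJ' _ _ derrho.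
have phiJ : vars phi' `<=` J by exact: subset_trans J'J.
have psiJ : vars psi' `<=` J by exact: subset_trans J'J.
set Y := setT `\` J in phiY psiY.
have YJ0 : Y `&` J = set0 by rewrite /Y setDE setTI setICl.
have YJT : Y `|` J = setT by rewrite /Y setDE setTI setUCl.
pose toY := restr (@subsetT _ Y); pose toJ := restr (@subsetT _ J).
pose prod := prodIn (@subsetT _ Y) (@subsetT _ J).
have prodE S1 S2 S1' S2' : closest (d setT) (prod S1 S1') (prod S2 S2') =
    prod (closest (d Y) S1 S2) (closest (d J) S1' S2').
  by apply: closest_prodIn YJT; exact: closest_prod.
have M_And p q : vars p `<=` Y -> vars q `<=` J ->
    M (And p q) = prod (toY @` M p) (toJ @` M q).
  move=> pY qJ; apply/seteqP; split=> m.
    by move=> /andP[mp mq]; split; apply/M_cylinder.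
  by case=> /(M_cylinder _ pY) mp /(M_cylinder _ qJ) mq; apply/andP.
have M_J q : vars q `<=` J -> M q = prod setT (toJ @` M q).
  move=> qJ; apply/seteqP; split=> m; first by split=> //; apply/M_cylinder.
  by case=> _ /(M_cylinder _ qJ).
apply: der_ax => m.
rewrite (M_J phi') // (M_J psi') // prodE => -[_ mJ].
have [n nY] : closest (d Y) (toY @` M phi) (toY @` M psi) !=set0.
  by apply: closest_neq0; apply: image_nonempty; exact: consistent_sat.
have [w [wY wJ]] := restr_glue (@subsetT _ Y) (@subsetT _ J) n (toJ m) YJ0.
rewrite -(sat_restr rhoJ wJ); apply: soundness derrho _ => r; apply.
by rewrite !M_And // prodE; split; rewrite ?wY ?wJ.
Qed.
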